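(* Let $K$ be a compact topological space. Then the spectrum $S_{\mathbf{1}}(C^0(K,\mathbb{R}))$ is naturally identified with $K$ (via $t\mapsto(X\mapsto X(t))$). In other words, for any $\phi\in S_{\mathbf{1}}(C^0(K,\mathbb{R}))$ there exists a unique $t\in K$ such that $\phi(X)=X(t)$ for all $X\in C^0(K,\mathbb{R})$.
   Context: Compact spaces are Hausdorff. $C^0(K,\mathbb{R})$ is the set of continuous real functions on $K$, regarded as a semi-field with the two laws $\max(\,,)$ (pointwise maximum) and $+$ (pointwise addition). $\mathbf{1}$ is the constant function equal to $1$. $S_{\mathbf{1}}(C^0(K,\mathbb{R}))$ is the set of maps $\phi:C^0(K,\mathbb{R})\to\mathbb{R}$ such that $\phi(\max(X,Y))=\max(\phi(X),\phi(Y))$ and $\phi(X+Y)=\phi(X)+\phi(Y)$ for all $X,Y$, and $\phi(\mathbf{1})=1$. *)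

(* Defs.v *)
From mathcomp Require Import all_boot all_order all_algebra.
From mathcomp Require Import all_classical all_reals topology.
From mathcomp Require Import normedtype.
Set Implicit Arguments.
Unset Strict Implicit.
Unset Printing Implicit Defensive.
Import Order.TTheory GRing.Theory Num.Theory numFieldNormedType.Exports.
Local Open Scope classical_set_scope.
Local Open Scope ring_scope.

(* C^0(K, R) is the type [continuousType K R] of bundled continuous functions,
   seen as a semi-field whose addition is the pointwise maximum [cts_max] and
   whose multiplication is the pointwise sum [cts_add].  The function [cts_one]
   is the constant 1, which is not the neutral element of [cts_add]. *)
Section MaxPlusContinuousFunctions.
Context {K : topologicalType} {R : realType}.
Implicit Types X Y : continuousType K R.

Lemma cts_max_continuous X Y : continuous (X \max Y).
Proof. by move=> t; apply: continuous_max; apply: cts_fun. Qed.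

Definition cts_max X Y : continuousType K R := mkcts (@cts_max_continuous X Y).

Lemma cts_add_continuous X Y : continuous (X \+ Y).
Proof. by move=> t; apply: cvgD; apply: cts_fun. Qed.

Definition cts_add X Y : continuousType K R := mkcts (@cts_add_continuous X Y).

Lemma cts_one_continuous : continuous (cst 1 : K -> R).
Proof. by move=> t; apply: cvg_cst. Qed.

Definition cts_one : continuousType K R := mkcts cts_one_continuous.

(* The set S_1(C^0(K, R)): morphisms for the two laws, normalised at the constant
   function 1.  No continuity or homogeneity is required of [phi]. *)
Definition spectrum1 : set (continuousType K R -> R) :=
  [set phi | [/\ forall X Y, phi (cts_max X Y) = Num.max (phi X) (phi Y),
                 forall X Y, phi (cts_add X Y) = phi X + phi Y
               & phi cts_one = 1]].

Definition cts_eval (t : K) : continuousType K R -> R := fun X => X t.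

End MaxPlusContinuousFunctions.

Arguments spectrum1 K R : clear implicits.
Arguments cts_eval {K R} t X.

(* Main.v *)
(* Write phi for an element of the spectrum.  It is monotone and additive, so it
   fixes the constants, and it is odd.  The open sets {Y < 0} with phi Y < 0 are
   nonempty (if Y >= 0 then phi Y >= 0) and stable under finite intersection (by
   max), so compactness yields a point t adherent to all of them, that is, Y t <= 0
   whenever phi Y < 0.  Taking Y = X - phi X - e gives X t <= phi X, and replacing X
   by - X gives the equality.  Uniqueness of t is Urysohn's lemma. *)
Require Import Defs.
From HB Require Import structures.
From mathcomp Require Import all_boot all_order all_algebra.
From mathcomp Require Import all_classical all_reals topology.
From mathcomp Require Import normedtype.
Import Order.TTheory GRing.Theory Num.Theory numFieldNormedType.Exports.
Local Open Scope classical_set_scope.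
Local Open Scope ring_scope.

(** Since [f] fixes the integers, monotonicity keeps [f y] below [y + 1] for every [y]. Applied to
    the multiples of [x], this bounds [n (f x - x)] by 1 for all [n], which the Archimedean property
    forbids if [f x > x]. Oddness gives the other inequality. *)
Lemma additive_homo_id (R : realType) (f : {additive R -> R}) :
  {homo f : x y / x <= y} -> f 1 = 1 -> f =1 id.
Proof.
move=> f_homo f1.
have f_floor y : f y <= y + 1.
  have /ltW/f_homo := floorD1_gt y.
  rewrite (raddfMz f) f1 => /le_trans; apply.
  by rewrite intrD lerD2r floor_le.
have f_le x : f x <= x.
  rewrite leNgt; apply/negP; rewrite -subr_gt0 => d_gt0.
  (* A natural number [n] above [1 / (f x - x)] makes [n (f x - x) > 1], against [f_floor] at
     [n x]. *)
  have := archi_boundP (ltW (_ : 0 < (f x - x)^-1)); rewrite invr_gt0 => /(_ d_gt0).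
  set n := Num.bound _.
  rewrite -[X in X < _]mul1r ltr_pdivrMr// ltNge mulrBr !mulr_natl -raddfMn.
  by rewrite lerBlDl f_floor.
move=> x; apply/eqP; rewrite eq_le f_le/=.
by have := f_le (- x); rewrite raddfN lerN2.
Qed.

Lemma cts_opp_continuous (K : topologicalType) (R : realType)
  (X : continuousType K R) : continuous (\- X).
Proof. by move=> t; apply: cvgN; apply: cts_fun. Qed.

Definition cts_opp {K : topologicalType} {R : realType} (X : continuousType K R) :
  continuousType K R := mkcts (@cts_opp_continuous K R X).

Definition cts_const (K : topologicalType) (R : realType) (c : R) :
  continuousType K R := cst c.

Arguments cts_const K {R} c.

Section Spectrum.
Context {R : realType} {K : topologicalType} {phi : continuousType K R -> R}
  (phiS : spectrum1 K R phi).
Implicit Types X Y : continuousType K R.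

(** The order is encoded in the first law: [X <= Y] amounts to [max(X, Y) = Y], an equation that
    [phi] preserves. *)
Lemma spectrum1_homo X Y : (forall t, X t <= Y t) -> phi X <= phi Y.
Proof.
have [phi_max _ _] := phiS => leXY.
have <- : cts_max X Y = Y by apply/continuousEP => t; exact/max_idPr.
by rewrite phi_max le_max lexx.
Qed.

Lemma spectrum1_const (c : R) : phi (cts_const K c) = c.
Proof.
have [_ phi_add phi_one] := phiS.
pose g c := phi (cts_const K c).
have gD : {morph g : x y / x + y}.
  by move=> x y; rewrite /g -phi_add; congr phi; apply/continuousEP.
(* Cancel [g 0] in [g 0 + g 0 = g 0]. *)
have g0 : g 0 = 0 by apply: (addrI (g 0)); rewrite -gD !addr0.
pose G : {additive R -> R} := HB.pack g (GRing.isNmodMorphism.Build R R g (g0, gD)).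
apply: (@additive_homo_id R G) => [x y xy|].
  exact: spectrum1_homo.
by rewrite -[RHS]phi_one; congr phi; apply/continuousEP.
Qed.

Lemma spectrum1_opp X : phi (cts_opp X) = - phi X.
Proof.
have [_ phi_add _] := phiS.
(* The right-hand 0 is read as [phi] of the constant 0, so that only an equality of functions
   remains. *)
apply/eqP; rewrite -addr_eq0 -phi_add -[eqbRHS]spectrum1_const.
by apply/eqP; congr phi; apply/continuousEP => t; exact: addNr.
Qed.

Lemma spectrum1_eval : compact [set: K] -> exists t, phi = cts_eval t.
Proof.
have [phi_max phi_add _] := phiS => compactK.
pose F := filter_from [set Y | phi Y < 0] (fun Y => [set t | Y t < 0]).
have FF : ProperFilter F.
  apply: filter_from_proper; first apply: filter_from_filter.
  - by exists (cts_const K (-1)); rewrite /= spectrum1_const ltrN10.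
  - move=> X Y /= X0 Y0; exists (cts_max X Y); first by rewrite /= phi_max gt_max X0.
    by move=> t /=; rewrite /mkcts gt_max => /andP.
  - move=> Y /= Y0; apply/set0P/eqP => /seteqP[noneg _].
    move: Y0; rewrite ltNge -[leLHS]spectrum1_const => /negP; apply.
    by apply: spectrum1_homo => t; rewrite leNgt; apply/negP => /noneg.
have [t [_]] := compactK F FF filterT; rewrite clusterE => tF.
(* Adherence gives only the weak inequality: the closure of [{Y < 0}] lies in the closed set
   [{Y <= 0}]. *)
have t_le0 Y : phi Y < 0 -> Y t <= 0.
  move=> Y0.
  have : closure [set s | Y s < 0] t by apply: tF; exists Y.
  have clY : closed [set s | Y s <= 0].
    apply: (@preimage_closed _ _ Y [set r | r <= 0]) => [s _|].
      exact: cts_fun.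
    exact: closed_le.
  by move=> tY; apply: clY; apply: closureS tY => s /ltW.
have t_le X : X t <= phi X.
  apply/ler_addgt0Pr => e e0.
  rewrite -subr_le0.
  (* [phi] sends this function to [- e]; the margin [e] makes the value strictly negative, as
     [t_le0] demands. *)
  apply: (t_le0 (cts_add X (cts_const K (- (phi X + e))))).
  by rewrite phi_add spectrum1_const opprD addNKr oppr_lt0.
exists t; apply/funext => X; apply/eqP; rewrite eq_le /cts_eval t_le andbT.
by have := t_le (cts_opp X); rewrite spectrum1_opp lerN2.
Qed.

End Spectrum.

Lemma cts_eval_spectrum1 (R : realType) (K : topologicalType) (t : K) :
  spectrum1 K R (cts_eval t).
Proof. by []. Qed.

Lemma cts_eval_inj (R : realType) (K : topologicalType) :
  compact [set: K] -> hausdorff_space K -> injective (@cts_eval K R).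
Proof.
move=> compactK hausdorffK s t eq_st; apply: contrapT => neq_st.
(* A compact Hausdorff space is normal with closed points, so some continuous function is 0 at [s]
   and 1 at [t]; equal evaluations would force [0 = 1]. *)
have : uniform_separator [set s] [set t].
  have acc := hausdorff_accessible hausdorffK.
  apply: (@normal_completely_regular R) => //; first exact: compact_normal.
  exact: accessible_closed_set1.
move=> /(@uniform_separatorP _ R)[f [f_cts _ fs ft]].
have /= : cts_eval s (mkcts f_cts) = cts_eval t (mkcts f_cts) by rewrite eq_st.
rewrite /cts_eval /mkcts/= (fs (f s))/=; last by exists s.
rewrite (ft (f t))/=; last by exists t.
by move=> /esym/eqP; rewrite oner_eq0.
Qed.

Theorem corollary1 (R : realType) (K : topologicalType)
    (compactK : compact [set: K]) (hausdorffK : hausdorff_space K) :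
  set_bij [set: K] (spectrum1 K R) cts_eval /\
  (forall phi : continuousType K R -> R, spectrum1 K R phi ->
     exists! t : K, forall X : continuousType K R, phi X = X t).
Proof.
split.
  split.
  - by move=> t _; exact: cts_eval_spectrum1.
  - by move=> s t _ _; exact: cts_eval_inj.
  - by move=> phi /spectrum1_eval/(_ compactK)[t ->]; exists t.
move=> phi /spectrum1_eval/(_ compactK)[t ->]; exists t; split => // s st.
by apply: (@cts_eval_inj R) => //; exact/funext.
Qed.
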